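(* Let $m\ge 2$ and $\tau=m/2$. For every instance with $m$ projects (and any number of agents), the solution $\mathbf{x}$ with $x_j=\frac{2}{m}$ for all $j\in[m]$ satisfies all agents. In addition, for each such $m$ there exists an instance with $m$ projects such that the minimum budget necessary to satisfy all agents, i.e. the minimum of $\sum_{j=1}^m x_j$ over all solutions $\mathbf{x}$ satisfying all agents, is at least $2-\frac{6}{m}$.
   Context: An instance with $n$ agents and $m$ projects consists of demands $d^i_j\in[0,1]$ for $i\in[n]=\{1,\dots,n\}$ and $j\in[m]$, here with $\sum_{j=1}^m d^i_j=1$ for every agent $i$. A solution is a vector $\mathbf{x}\in[0,1]^m$; its total budget is $\sum_{j=1}^m x_j$, which here may be smaller or larger than $1$. Given a threshold $\tau\in[1,m]$ (not necessarily an integer), agent $i$ is satisfied by $\mathbf{x}$ if the number of projects $j\in[m]$ with $x_j\ge d^i_j$ is at least $\tau$. *)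

(* Defs.v *)
From HB Require Import structures.
From mathcomp Require Import all_boot all_order all_algebra.
From mathcomp Require Import reals.

Set Implicit Arguments.
Unset Strict Implicit.
Unset Printing Implicit Defensive.

Import Order.TTheory GRing.Theory Num.Theory.
Local Open Scope ring_scope.

(* Row [i] of [d] lists the demands of agent [i]. *)
Definition is_instance (R : realType) (n m : nat) (d : 'M[R]_(n, m)) : Prop :=
  (forall i j, 0 <= d i j <= 1) /\ (forall i, \sum_(j < m) d i j = 1).

Definition is_solution (R : realType) (m : nat) (x : 'rV[R]_m) : Prop :=
  forall j, 0 <= x 0 j <= 1.

Definition budget (R : realType) (m : nat) (x : 'rV[R]_m) : R :=
  \sum_(j < m) x 0 j.

Definition satisfied (R : realType) (n m : nat) (d : 'M[R]_(n, m)) (tau : R)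
    (x : 'rV[R]_m) (i : 'I_n) : Prop :=
  tau <= #|[set j : 'I_m | d i j <= x 0 j]|%:R.

Definition satisfies_all (R : realType) (n m : nat) (d : 'M[R]_(n, m))
    (tau : R) (x : 'rV[R]_m) : Prop :=
  is_solution x /\ forall i, satisfied d tau x i.

Definition is_min_budget (R : realType) (n m : nat) (d : 'M[R]_(n, m))
    (tau B : R) : Prop :=
  (exists x, satisfies_all d tau x /\ budget x = B) /\
  (forall x, satisfies_all d tau x -> B <= budget x).

(* Main.v *)
(** For the lower bound, take one agent for every demand vector whose entries
    are multiples of [1/N], where [N = m^2].  Rounding a solution down to this
    grid changes nobody's satisfaction, so the minimum is attained on the grid.
    Put [k = floor(m/2) + 1].  If the entries of a grid solution on some [k]
    projects summed to at most [1 - k/N], raising each of them by [1/N] and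
    completing to total [1] would give the demands of an agent left unsatisfied.
    Averaging the resulting inequality over the [m] cyclic translates of a fixed
    [k]-set bounds the budget below by about [m/k]. *)
Require Import Defs.
From HB Require Import structures.
From mathcomp Require Import all_boot all_order all_algebra.
From mathcomp Require Import reals.
From mathcomp Require Import zify lra.

Set Implicit Arguments.
Unset Strict Implicit.
Unset Printing Implicit Defensive.

Import Order.TTheory GRing.Theory Num.Theory.
Local Open Scope ring_scope.

(** Each project that fails agent [i] takes more than [2/m] of that agent's total demand [1], so at
    most [m/2] projects fail. *)
Lemma satisfies_all_const (R : realType) (n m : nat) (d : 'M[R]_(n, m)) :
  (2 <= m)%N -> is_instance d ->
  satisfies_all d (m%:R / 2) (const_mx (2 / m%:R) : 'rV[R]_m).
Proof.
move=> hm [dge0 dsum1].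
have m_gt0 : 0 < m%:R :> R by rewrite ltr0n; lia.
have m_ge2 : 2 <= m%:R :> R by rewrite ler_nat.
split=> [j|i]; first by rewrite mxE divr_ge0 ?ler0n //= ler_pdivrMr // mul1r.
rewrite /satisfied; set G := [set j | _].
have cardG : #|G|%:R = m%:R - #|~: G|%:R :> R.
  by rewrite -[X in X%:R - _](card_ord m) -(cardsC G) natrD addrK.
suff : #|~: G|%:R * (2 / m%:R) <= 1 :> R.
  by rewrite mulrA ler_pdivrMr // mul1r cardG => ?; lra.
rewrite -[leRHS](dsum1 i) (bigID (mem (~: G))) /= -[leLHS]addr0.
apply: lerD; last by apply: sumr_ge0 => j _; case/andP: (dge0 i j).
rewrite mulr_natl -sumr_const; apply: ler_sum => j.
by rewrite !inE mxE -ltNge => /ltW.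
Qed.

Section Grid.
Variables m N : nat.
Implicit Types f g : {ffun 'I_m -> 'I_N.+1}.

Definition grid_demands : {set {ffun 'I_m -> 'I_N.+1}} :=
  [set f : {ffun 'I_m -> 'I_N.+1} | \sum_j f j == N :> nat]%N.

(** Satisfaction at threshold [m/2], in units of [1/N] and with the fraction cleared. Being boolean
    on a finite type, it allows a minimizer to be chosen. *)
Definition grid_feasible g : bool :=
  [forall f in grid_demands, m <= (#|[set j | f j <= g j]|).*2]%N.

Lemma grid_feasible_max : grid_feasible [ffun=> ord_max].
Proof.
apply/forall_inP => f _.
suff -> : [set j | (f j <= [ffun=> @ord_max N] j)%N] = [set: 'I_m].
  by rewrite cardsT card_ord; lia.
by apply/setP => j; rewrite !inE ffunE -ltnS ltn_ord.
Qed.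

Lemma grid_feasible_sum_ge g (S : {set 'I_m}) :
  grid_feasible g -> (m < (#|S|).*2)%N -> (N < \sum_(j in S) g j + #|S|)%N.
Proof.
move=> /forall_inP gP mS; rewrite ltnNge; apply/negP => sumS_le.
have [j0 j0S] : exists j, j \in S by apply/card_gt0P; lia.
(* The slack up to total [N] is placed on one project [j0] of [S], so that [h] exceeds [g] on all of
   [S]. Only projects outside [S], fewer than [m/2], can then count for this agent. *)
pose h j := ((if j \in S then (g j).+1 else 0)
             + (if j == j0 then N - (\sum_(i in S) g i + #|S|) else 0))%N.
have sumh : (\sum_j h j = N)%N.
  rewrite big_split /= -!big_mkcond /= big_pred1_eq.
  under eq_bigr do rewrite -addn1.
  by rewrite big_split /= sum1_card subnKC.
have h_le j : (h j < N.+1)%N by rewrite ltnS -sumh (bigD1 j) //= leq_addr.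
pose f : {ffun 'I_m -> 'I_N.+1} := [ffun j => Ordinal (h_le j)].
have fA : f \in grid_demands.
  by rewrite inE -[eqbRHS]sumh; apply/eqP/eq_bigr => j _; rewrite ffunE.
have sub : [set j | (f j <= g j)%N] \subset ~: S.
  apply/subsetP => j; rewrite !inE ffunE /= /h; apply: contraTN => ->.
  by rewrite -ltnNge; lia.
move: (gP f fA) (subset_leq_card sub) mS (cardsC S); rewrite card_ord.
by move: #|_| #|~: S| #|S| => good s' s; lia.
Qed.

End Grid.

(** Double counting: every point lies in exactly [#|K|] of the translates of [K]. *)
Lemma sum_translates (V : finZmodType) (F : V -> nat) (K : {set V}) :
  (\sum_a \sum_(j in [set (a + i)%R | i in K]) F j = #|K| * \sum_j F j)%N.
Proof.
under eq_bigr => a _ do rewrite (big_imset _ (in2W (addrI a))) /=.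
rewrite exchange_big /= -sum_nat_const; apply: eq_bigr => i _.
by rewrite [RHS](reindex_inj (addIr i)).
Qed.

Lemma average_bound (m k s : nat) : (m < k.*2 <= m.+2)%N ->
  (m * (m ^ 2).+1 <= k * s + m * k)%N -> (2 * m ^ 2 <= s + 6 * m)%N.
Proof.
move=> /andP[k_gt k_le] key.
have : (k * (2 * m ^ 2) <= k * (s + 6 * m))%N.
  (* From [2k <= m + 2] comes [2km <= m^2 + 2m], and [m < 2k] gives [2m < 4k]. *)
  have : (m * (2 * k * m) <= m * (m * m + 1 + 5 * k))%N.
    by rewrite leq_mul2l; apply/orP; right; nia.
  nia.
by rewrite leq_pmul2l //; lia.
Qed.

Lemma grid_feasible_budget (m : nat) (g : {ffun 'I_m -> 'I_(m ^ 2).+1}) :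
  (2 <= m)%N -> grid_feasible g -> (2 * m ^ 2 <= \sum_j g j + 6 * m)%N.
Proof.
(* The successor form gives ['I_M] its cyclic group structure, needed for translates. *)
case: m g => // m; set M := m.+1 => g hm gP.
(* The least size with [M < 2k]; it is at most [M] because [M >= 2]. *)
pose k := (M./2).+1.
have le_kM : (k <= M)%N by rewrite /k; lia.
pose K : {set 'I_M} := [set widen_ord le_kM i | i : 'I_k].
have cardK : #|K| = k.
  by rewrite card_imset ?card_ord // => i j /(congr1 val) /= /val_inj.
have translate_ge (a : 'I_M) :
  (M ^ 2 < \sum_(j in [set (a + i)%R | i in K]) g j + k)%N.
  rewrite -[X in (_ < _ + X)%N]cardK -(card_imset K (addrI a)).
  apply: grid_feasible_sum_ge => //.
  by rewrite card_imset ?cardK ?/k; [lia | exact: addrI].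
have := sum_translates (fun j => g j : nat) K; rewrite cardK.
have : (M * (M ^ 2).+1 <=
    \sum_(a : 'I_M) \sum_(j in [set (a + i)%R | i in K]) g j + M * k)%N.
  rewrite -[X in (X * _ <= _)%N](card_ord M) -[X in (_ + X * _)%N](card_ord M).
  by rewrite -!sum_nat_const -big_split; apply: leq_sum.
by move=> + sumE; rewrite sumE; apply: average_bound; rewrite /k; lia.
Qed.

Section GridInstance.
Variables (R : realType) (m N : nat).
Hypothesis N_gt0 : (0 < N)%N.
Implicit Types f g : {ffun 'I_m -> 'I_N.+1}.

Definition grid_instance : 'M[R]_(#|grid_demands m N|, m) :=
  \matrix_(i, j) (((enum_val i : {ffun 'I_m -> 'I_N.+1}) j : nat)%:R / N%:R).

Definition grid_vector g : 'rV[R]_m := \row_j ((g j : nat)%:R / N%:R).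

(** For a solution, entries are at most [1], so the truncation is at most [N] and the default of
    [inord] never occurs. *)
Definition round_down (x : 'rV[R]_m) : {ffun 'I_m -> 'I_N.+1} :=
  [ffun j => inord (Num.truncn (x 0 j * N%:R))].

Let N_gt0R : 0 < N%:R :> R. Proof. by rewrite ltr0n. Qed.

Lemma grid_entry_bounds (a : 'I_N.+1) : 0 <= ((a : nat)%:R / N%:R : R) <= 1.
Proof.
by rewrite divr_ge0 ?ler0n //= ler_pdivrMr // mul1r ler_nat -ltnS ltn_ord.
Qed.

Lemma grid_instanceP : is_instance grid_instance.
Proof.
split=> [i j|i]; first by rewrite mxE grid_entry_bounds.
under eq_bigr do rewrite mxE.
rewrite -mulr_suml -natr_sum.
have := enum_valP i; rewrite inE => /eqP ->.
by rewrite divff // gt_eqF.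
Qed.

Lemma budget_grid_vector g : budget (grid_vector g) = (\sum_j g j)%N%:R / N%:R.
Proof.
by rewrite /budget natr_sum mulr_suml; apply: eq_bigr => j _; rewrite mxE.
Qed.

Lemma half_le_natr (c : nat) : (m%:R / 2 <= c%:R :> R) = (m <= c.*2)%N.
Proof. by rewrite ler_pdivrMr ?ltr0n // -natrM muln2 ler_nat. Qed.

Lemma satisfies_all_grid_vector g :
  grid_feasible g -> satisfies_all grid_instance (m%:R / 2) (grid_vector g).
Proof.
move=> /forall_inP gP; split=> [j|i]; first by rewrite mxE grid_entry_bounds.
rewrite /satisfied half_le_natr (leq_trans (gP _ (enum_valP i))) // leq_double.
apply/subset_leq_card/subsetP => j; rewrite !inE !mxE => le_fg.
by rewrite ler_pM2r ?invr_gt0 // ler_nat.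
Qed.

Lemma round_downE x j : is_solution x ->
  round_down x j = Num.truncn (x 0 j * N%:R) :> nat.
Proof.
move=> /(_ j) /andP[x_ge0 x_le1]; rewrite ffunE inordK // ltnS.
rewrite -(ler_nat R) (@le_trans _ _ (x 0 j * N%:R)) ?ler_piMl ?ler0n //.
by rewrite truncn_le mulr_ge0 ?ler0n.
Qed.

Lemma budget_round_down x : is_solution x ->
  budget (grid_vector (round_down x)) <= budget x.
Proof.
move=> xP; apply: ler_sum => j _; rewrite mxE round_downE // ler_pdivrMr //.
by rewrite truncn_le mulr_ge0 ?ler0n //; case/andP: (xP j).
Qed.

(** An integer [a] with [a/N <= x 0 j] is at most the integer part of [N] times [x 0 j], so no grid
    demand that was met is lost. *)
Lemma round_down_feasible x :
  satisfies_all grid_instance (m%:R / 2) x -> grid_feasible (round_down x).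
Proof.
move=> [xP xsat]; apply/forall_inP => f fA.
have := xsat (enum_rank_in fA f); rewrite /satisfied half_le_natr => /leq_trans.
apply; rewrite leq_double; apply/subset_leq_card/subsetP => j.
rewrite !inE !mxE enum_rankK_in // round_downE // ler_pdivrMr // => le_fx.
by rewrite truncn_ge_nat // mulr_ge0 ?ler0n //; case/andP: (xP j).
Qed.

(** A cheapest grid solution exists by finiteness, and every solution rounds down to a grid solution
    that costs no more. *)
Lemma grid_instance_min :
  exists2 g, grid_feasible g &
    is_min_budget grid_instance (m%:R / 2) (budget (grid_vector g)).
Proof.
case: (arg_minnP (fun g : {ffun 'I_m -> 'I_N.+1} => \sum_j g j)%N
  (grid_feasible_max m N)) => g gP gmin.
exists g => //; split.
  by exists (grid_vector g); split=> //; apply: satisfies_all_grid_vector.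
move=> x xP; apply: le_trans (budget_round_down xP.1).
rewrite !budget_grid_vector ler_pM2r ?invr_gt0 // ler_nat.
exact/gmin/round_down_feasible.
Qed.

End GridInstance.

(** Ensures that the instance has an agent: one who puts the whole demand on project [0]. *)
Lemma grid_demands_gt0 (m N : nat) : (0 < m)%N -> (0 < #|grid_demands m N|)%N.
Proof.
case: m => // m _; apply/card_gt0P.
exists [ffun j => if j == ord0 then ord_max else ord0]; rewrite inE.
rewrite (bigD1 ord0) //= ffunE eqxx big1 ?addn0 // => j /negPf j0.
by rewrite ffunE j0.
Qed.

Theorem theorem8 (R : realType) (m : nat) (hm : (2 <= m)%N) :
  (forall (n : nat) (d : 'M[R]_(n, m)),
     is_instance d ->
     satisfies_all d (m%:R / 2) (const_mx (2 / m%:R) : 'rV[R]_m)) /\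
  (exists (n : nat) (d : 'M[R]_(n, m)),
     [/\ (0 < n)%N, is_instance d &
       exists B : R, is_min_budget d (m%:R / 2) B /\ 2 - 6 / m%:R <= B]).
Proof.
split=> [n d|]; first exact: satisfies_all_const.
have m_gt0 : (0 < m)%N by exact: ltnW.
have N_gt0 : (0 < m ^ 2)%N by rewrite expn_gt0 m_gt0.
exists #|grid_demands m (m ^ 2)|, (grid_instance R m (m ^ 2)).
split; [exact: grid_demands_gt0 | exact: grid_instanceP |].
have [g gP gmin] := grid_instance_min R m N_gt0.
exists (budget (grid_vector R g)); split=> //.
rewrite budget_grid_vector ler_pdivlMr ?ltr0n //.
have mR : m%:R != 0 :> R by rewrite pnatr_eq0 -lt0n.
(* Scaling by [N = m^2] turns the claim into the integer bound of [grid_feasible_budget]. *)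
have -> : (2 - 6 / m%:R) * (m ^ 2)%:R = (2 * m ^ 2)%:R - (6 * m)%:R :> R.
  by rewrite !natrM mulrBl [6 / _ * _]mulrA divfK.
by rewrite lerBlDr -natrD ler_nat grid_feasible_budget.
Qed.
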